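(* Let $p$ be an odd prime, and let $A_n=\sum_{k=0}^n\binom{2k}k\binom{2n-2k}{n-k}\binom nk^2$. If $p\equiv 1,3\pmod 8$, so that $p=x^2+2y^2$ for some integers $x,y$, then $\sum_{n=0}^{p-1}\frac{A_n}{8^n}\equiv 4x^2\pmod p$. If $p\equiv 5,7\pmod 8$, then $\sum_{n=0}^{p-1}\frac{A_n}{8^n}\equiv 0\pmod p$.
   Context: Congruences modulo $p$ are between rational numbers whose denominators are prime to $p$. *)

(* Defs.v *)
From mathcomp Require Import all_boot all_order all_algebra.

Set Implicit Arguments.
Unset Strict Implicit.
Unset Printing Implicit Defensive.

Import Order.TTheory GRing.Theory Num.Theory.

Local Open Scope ring_scope.

Definition A (n : nat) : nat :=
  (\sum_(0 <= k < n.+1)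
     'C(2 * k, k) * 'C(2 * n - 2 * k, n - k) * 'C(n, k) ^ 2)%N.

Definition prime_to_denom (p : nat) (a : rat) : Prop :=
  coprime p `|denq a|.

(* Only rationals with denominator prime to [p] are ever congruent. As [numq]
   is the numerator in lowest terms, the last clause says that [a - b] is [p]
   times a rational with denominator prime to [p]. *)
Definition rat_congr (p : nat) (a b : rat) : Prop :=
  [/\ prime_to_denom p a, prime_to_denom p b & (p%:Z %| numq (a - b))%Z].

(* Main.v *)
Require Import Defs.
From mathcomp Require Import all_boot all_order all_algebra all_field.
From mathcomp Require Import ring lra zify.

Import Order.TTheory GRing.Theory Num.Theory.

Local Open Scope ring_scope.

(** Write [N = (p-1)/2] and [m = floor (p/4)], and compute in characteristic
    [p]. As ['C(2k, k) = (-4)^k 'C(N, k)], the sum is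
    [sum_(i,j) 'C(N, i) 'C(N, j) 'C(i+j, i)^2 (-1/2)^(i+j)], that is, the
    coefficient of [u^N v^N] in
    [((1 - w/2) (uv - w/2))^N = (uv - (1-u^2)(1-v^2)/4)^N] where
    [w = (1+u)(1+v)]. Expanding the right-hand side gives
    [sum_j 'C(N, 2j) 'C(2j, j)^2 / 16^j]. Modulo [p] this is the coefficient of
    [t^m z^N] in [(z(1-t)^2 + (1+z)^2 t)^N = ((z+t)(1+zt))^N], which is
    ['C(N, m/2)^2] if [m] is even and [0] otherwise.

    If [p = 8k+1] or [p = 8k+3], then [m/2 = k], and it remains to see that
    ['C(N, k)^2 = 4 x^2] modulo [p]. Let [w] be a primitive eighth root of unity
    in the field [K] with [p] (resp. [p^2]) elements, [i = w^2], and
    [theta t = (1 + t i)^(N-k) (1 - t i)^k] for [t] in the prime field. The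
    values of [theta] are [0] or eighth roots of unity, so [sum_t theta t] lifts
    to a Jacobi (resp. Eisenstein) sum [J] in [Z[zeta_8]], which lies in
    [Z[sqrt(-2)]] because [theta (-t) = theta t ^ 3], and has norm [p]. Thus
    [J = x + y sqrt(-2)] with [p = x^2 + 2 y^2]. In [K], the sum of [theta t] is
    [0] for degree reasons, and that of [theta t ^ -1] is ['C(N, k)] up to sign;
    as the two add up to the trace [2 x], we get ['C(N, k) = 2 x] up to sign. *)

(** * Binomial coefficients in characteristic p *)

Lemma natr_mul_bin_left (R : pzRingType) n k :
  k.+1%:R * 'C(n, k.+1)%:R = (n%:R - k%:R) * 'C(n, k)%:R :> R.
Proof.
case: (leqP k n) => kn; first by rewrite -natrB // -!natrM mul_bin_left.
by rewrite !bin_small ?mulr0 //; lia.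
Qed.

Section CharP.
Variables (F : fieldType) (p : nat).
Hypothesis pF : p \in [pchar F].
Hypothesis p_odd : odd p.
Let p_prime : prime p. Proof. by case/andP: pF. Qed.
Local Notation N := (p./2).

Lemma natf_neq0_lt n : (0 < n < p)%N -> n%:R != 0 :> F.
Proof.
by case/andP=> n0 np; rewrite -(dvdn_pcharf pF); apply/negP=> /dvdn_leq; lia.
Qed.

Lemma natf_half : 2 * N%:R = -1 :> F.
Proof.
have pE : p = (2 * N).+1 by lia.
apply/eqP; rewrite -subr_eq0 opprK -natrM -[1]/(1%:R) -natrD addn1 -pE.
by rewrite pcharf0.
Qed.

Lemma two_neq0 : 2 != 0 :> F.
Proof. by apply: natf_neq0_lt; have := prime_gt1 p_prime; lia. Qed.

Lemma four_neq0 : 4 != 0 :> F.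
Proof. by rewrite (natrM F 2 2) mulf_neq0 ?two_neq0. Qed.

(** In [F], N = -1/2, so both sides obey the same recurrence in [k]: -4(N - k) = 2(2k + 1), and k +
    1 stays invertible below [p]. *)
Lemma central_bin_half k : (k < p)%N -> 'C(2 * k, k)%:R = (-4) ^+ k * 'C(N, k)%:R :> F.
Proof.
elim: k => [|k IHk] kp; first by rewrite !bin0 mul1r.
apply: (mulfI (@natf_neq0_lt k.+1 _)); first by lia.
have e1 : (k.+1 * 'C(2 * k.+1, k.+1) = 2 * (2 * k).+1 * 'C(2 * k, k))%N.
  have h1 : ((2 * k).+1 * 'C(2 * k, k) = k.+1 * 'C((2 * k).+1, k))%N.
    by rewrite mul_bin_down; congr (_ * _)%N; lia.
  have -> : (2 * k.+1 = (2 * k).+2)%N by lia.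
  by rewrite -mul_bin_diag /= -mulnA h1 mulnA; congr (_ * _)%N; lia.
rewrite exprS.
have -> (x y z w : F) : x * (y * z * w) = z * (y * (x * w)) by ring.
rewrite (natr_mul_bin_left _ N) -natrM e1 !natrM IHk ?(ltnW kp) // -[(2 * k).+1]addn1 natrD natrM.
have -> : -4 * ((N%:R - k%:R) * 'C(N, k)%:R) =
  (- 2 * (2 * N%:R) + 4 * k%:R) * 'C(N, k)%:R :> F by ring.
rewrite natf_half; ring.
Qed.

(** Upper negation: in [F] the upper index p - 1 - a is -(a + 1). *)
Lemma bin_pred_pchar a i : (a + i < p)%N ->
  (-1) ^+ i * 'C(p.-1 - a, i)%:R = 'C(a + i, i)%:R :> F.
Proof.
elim: i => [|i IHi] aip; first by rewrite !bin0 mul1r.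
apply: (mulfI (@natf_neq0_lt i.+1 _)); first by lia.
have -> : i.+1%:R * ((-1) ^+ i.+1 * 'C(p.-1 - a, i.+1)%:R) =
   - ((-1) ^+ i * (i.+1 * 'C(p.-1 - a, i.+1))%:R) :> F by rewrite natrM exprS; ring.
rewrite mul_bin_left addnS -natrM -mul_bin_diag !natrM -IHi; last by lia.
have -> : (p.-1 - a - i)%:R = - (a + i).+1%:R :> F.
  apply/eqP; rewrite -subr_eq0 opprK -natrD.
  have -> : (p.-1 - a - i + (a + i).+1 = p)%N by lia.
  by rewrite pcharf0.
ring.
Qed.

(** Up to the common factor 1/((2j + 1)(2j + 2)), advancing [j] multiplies the left side by (N -
    2j)(N - 2j - 1) and the right side by -4(m + j + 1)(m - j). These agree because N is 2m or 2m +
    1 and 2N = -1. *)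
Lemma bin_half_quarter j : (2 * j < p)%N ->
  'C(N, 2 * j)%:R = (-4) ^+ j * 'C(p %/ 4 + j, 2 * j)%:R :> F.
Proof.
set m := (p %/ 4)%N.
elim: j => [|j IHj] jp; first by rewrite !bin0 mul1r.
have n1 := @natf_neq0_lt (2 * j).+1 ltac:(lia).
have n2 := @natf_neq0_lt (2 * j).+2 ltac:(lia).
apply: (mulfI n2); apply: (mulfI n1).
have mul_bin_left2 n i : i.+1%:R * (i.+2%:R * 'C(n, i.+2)%:R) =
    (n%:R - i%:R) * (n%:R - i%:R - 1) * 'C(n, i)%:R :> F.
  by rewrite natr_mul_bin_left mulrCA natr_mul_bin_left -[i.+1]addn1 natrD; ring.
have e1 := mul_bin_left2 N (2 * j)%N.
have e2 : (2 * j).+1%:R * ((2 * j).+2%:R * 'C(m + j.+1, (2 * j).+2)%:R) =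
    (m%:R + j%:R + 1) * (m%:R - j%:R) * 'C(m + j, 2 * j)%:R :> F.
  rewrite addnS -natrM -mul_bin_diag natrM mulrCA.
  case: (leqP j m) => jm.
    rewrite -[_%:R * 'C(_, _)%:R]natrM mul_bin_left natrM.
    have -> : (m + j - 2 * j = m - j)%N by lia.
    by rewrite natrB //= -[(m + j).+1]addn1 !natrD; ring.
  by rewrite !bin_small ?mulr0 //; lia.
have -> : (2 * j.+1 = (2 * j).+2)%N by lia.
rewrite e1 IHj; last by lia.
rewrite exprS.
have -> (x y z : F) : x * (y * (-4 * (-4) ^+ j * z)) = (-4) ^+ j * (-4 * (x * (y * z))) by ring.
rewrite e2.
have H : (N%:R - (2 * j)%:R) * (N%:R - (2 * j)%:R - 1) =
    -4 * ((m%:R + j%:R + 1) * (m%:R - j%:R)) :> F.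
  apply/eqP; rewrite -subr_eq0; apply/eqP.
  have -> (x : F) : x - -4 * ((m%:R + j%:R + 1) * (m%:R - j%:R)) =
    x + 4 * ((m%:R + j%:R + 1) * (m%:R - j%:R)) by ring.
  have hN : N = (2 * m)%N \/ N = (2 * m + 1)%N by rewrite /m; lia.
  have /eqP := natf_half; rewrite -addr_eq0 => /eqP.
  have hN2 : N%:R = 2 * m%:R :> F \/ N%:R = 2 * m%:R + 1 :> F.
    by case: hN => ->; [left; rewrite natrM | right; rewrite natrD natrM].
  (* In both cases the difference of the two sides is 2(m - j)(2N + 1). *)
  by rewrite natrM; case: hN2 => -> h; rewrite -[RHS](mulr0 (2 * m%:R - 2 * j%:R)) -h; ring.
by rewrite mulrA H; ring.
Qed.

End CharP.

(** * Coefficient extraction *)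

Section Coef2.
Variable R : comNzRingType.
Implicit Types (f g : {poly R}) (P : {poly {poly R}}).

(** The product f(u) g(v), where [u] is the inner and [v] the outer variable; its coefficients split
    into products of univariate ones. *)
Definition polyM2 f g : {poly {poly R}} := f%:P * map_poly polyC g.

Lemma coef_polyM2 f g i j : (polyM2 f g)`_i`_j = f`_j * g`_i.
Proof. by rewrite coefCM coef_map coefMC. Qed.

Lemma polyM2M f g f' g' : polyM2 f g * polyM2 f' g' = polyM2 (f * f') (g * g').
Proof. by rewrite /polyM2 !rmorphM /= mulrACA. Qed.

Lemma polyM2X f g n : polyM2 f g ^+ n = polyM2 (f ^+ n) (g ^+ n).
Proof. by rewrite /polyM2 exprMn !rmorphXn. Qed.

Lemma coef_1DZX_exp (a : R) n k : ((1 + a *: 'X) ^+ n)`_k = a ^+ k * 'C(n, k)%:R.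
Proof.
rewrite exprDn coef_sum.
have e i : ((1 : {poly R}) ^+ (n - i) * (a *: 'X) ^+ i *+ 'C(n, i))`_k =
    if k == i then a ^+ i * 'C(n, i)%:R else 0.
  rewrite expr1n mul1r coefMn exprZn coefZ coefXn.
  by case: eqP => _; rewrite ?mulr1 ?mulr0 ?mul0rn // mulr_natr.
under eq_bigr => i _ do rewrite e.
case: (ltnP k n.+1) => kn.
  rewrite (bigD1 (Ordinal kn)) //= eqxx big1 ?addr0 // => i ik.
  by rewrite ifN // eq_sym; apply: contraNN ik => /eqP ik; apply/eqP/val_inj.
rewrite big1 ?bin_small ?mulr0 // => i _.
by rewrite gtn_eqF // (leq_trans _ kn).
Qed.

Lemma coef_1DX_exp n k : ((1 + 'X : {poly R}) ^+ n)`_k = 'C(n, k)%:R.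
Proof. by rewrite -['X]scale1r coef_1DZX_exp expr1n mul1r. Qed.

Lemma coef_1BX_exp n k : ((1 - 'X : {poly R}) ^+ n)`_k = (-1) ^+ k * 'C(n, k)%:R.
Proof. by rewrite -scaleN1r coef_1DZX_exp. Qed.

Lemma coef_1BX2_exp_diag n :
  ((1 - 'X^2 : {poly R}) ^+ n)`_n = if odd n then 0 else (-1) ^+ n./2 * 'C(n, n./2)%:R.
Proof.
have -> : (1 - 'X^2 : {poly R}) = (1 - 'X) \Po 'X^2 by rewrite rmorphB rmorph1 /= comp_polyX.
rewrite -rmorphXn /= coef_comp_poly_Xn // dvdn2 divn2 coef_1BX_exp.
by case: odd.
Qed.

Lemma coef_shift_exp f n l : (l <= n)%N -> ('X^(n - l) * f)`_n = f`_l.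
Proof. by move=> ln; rewrite coefXnM ltnNge leq_subr subKn. Qed.

Lemma sum_even_terms (f : nat -> R) n :
  \sum_(0 <= l < n) (if odd l then 0 else f l./2) = \sum_(0 <= j < uphalf n) f j.
Proof.
elim: n => [|n IHn]; first by rewrite !big_geq.
rewrite big_nat_recr //= IHn uphalf_half.
by case: (boolP (odd n)) => on; rewrite ?addr0 // add0n big_nat_recr.
Qed.

End Coef2.

Arguments polyM2 {R} f g.

(** Two expansions of the coefficient of u^N v^N in one N-th power: on the left each of two factors
    is expanded separately; on the right their product uv + d(1 - u^2)(1 - v^2) is, where only even
    powers of the second term contribute. *)
Lemma double_sum_bin (F : fieldType) N : 2 != 0 :> F ->
  \sum_(0 <= i < N.+1) \sum_(0 <= j < N.+1)
     'C(N, i)%:R * 'C(N, j)%:R * 'C(i + j, j)%:R ^+ 2 * (- 2^-1) ^+ (i + j) =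
  \sum_(0 <= j < (uphalf N.+1)) 'C(N, 2 * j)%:R * 'C(2 * j, j)%:R ^+ 2 * 16^-1 ^+ j :> F.
Proof.
move=> n2.
have n4 : 4 != 0 :> F by rewrite (natrM F 2 2) mulf_neq0.
(* The constants -1/2 and -1/4 become variables, tied by 2c = -1 and d = -c^2, so that polynomial
   identities need no division. *)
have [c [cE cC]] : exists c : F, - 2^-1 = c /\ 2 * c = -1 by exists (- 2^-1); split=> //; field.
have [d [dE dC]] : exists d : F, - 4^-1 = d /\ d = - c ^+ 2.
  by exists (- 4^-1); split=> //; rewrite -cE; field; rewrite n2 n4.
rewrite cE.
pose w := polyM2 (c *: (1 + 'X)) (1 + 'X); pose uv : {poly {poly F}} := polyM2 'X 'X.
pose h := polyM2 (d *: (1 - 'X^2)) (1 - 'X^2).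
have prodE : (1 + w) * (uv + w) = uv + h.
  have factored (T : comNzRingType) (e u v : T) : 2 * e = -1 ->
      (1 + e * (1 + u) * (1 + v)) * (u * v + e * (1 + u) * (1 + v)) =
      u * v + - (e * e) * (1 - u * u) * (1 - v * v).
    move=> e2; apply/eqP; rewrite -subr_eq0; apply/eqP.
    (* The two sides differ by e(1 + u)(1 + v)(1 + uv) times 2e + 1, which is 0. *)
    rewrite -[RHS](mulr0 (e * (1 + u) * (1 + v) * (1 + u * v))).
    rewrite -[X in _ = _ * X](subrr (-1)) -{1}e2.
    by ring.
  rewrite /w /uv /h /polyM2 -!mul_polyC dC.
  rewrite !(rmorphD, rmorphB, rmorphN, rmorphM, rmorphXn, rmorph1) /= map_polyX.
  by apply: factored; rewrite mulr_natl -!polyCMn -mulr_natl cC !rmorphN !rmorph1.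
have := congr1 (fun P : {poly {poly F}} => (P ^+ N)`_N`_N) prodE.
rewrite exprMn !exprDn.
have e1 i : w ^+ i = polyM2 (c ^+ i *: (1 + 'X) ^+ i) ((1 + 'X) ^+ i).
  by rewrite polyM2X exprZn.
have e2 j : uv ^+ j = polyM2 'X^j 'X^j by rewrite polyM2X.
have e3 l : h ^+ l = polyM2 (d ^+ l *: (1 - 'X^2) ^+ l) ((1 - 'X^2) ^+ l).
  by rewrite polyM2X exprZn.
rewrite mulr_suml !coef_sum.
have -> : \sum_(i < N.+1) ((1 ^+ (N - i) * w ^+ i *+ 'C(N, i)) *
     (\sum_(j < N.+1) uv ^+ (N - j) * w ^+ j *+ 'C(N, j)))`_N`_N =
  \sum_(0 <= i < N.+1) \sum_(0 <= j < N.+1)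
     'C(N, i)%:R * 'C(N, j)%:R * 'C(i + j, j)%:R ^+ 2 * c ^+ (i + j).
  rewrite big_mkord; apply: eq_bigr => i _.
  rewrite mulr_sumr !coef_sum big_mkord; apply: eq_bigr => j _.
  rewrite expr1n mul1r mulrnAl [in LHS]mulrnAr !coefMn mulrCA -exprD e1 e2 polyM2M.
  have jN : (j <= N)%N by rewrite -ltnS.
  rewrite coef_polyM2 -scalerAr coefZ !(coef_shift_exp _ _ _ _ jN) !coef_1DX_exp.
  have -> (x : F) a b : x *+ a *+ b = b%:R * (a%:R * x) by rewrite !mulr_natl.
  ring.
move=> ->.
rewrite -(sum_even_terms F (fun j => 'C(N, 2 * j)%:R * 'C(2 * j, j)%:R ^+ 2 * 16^-1 ^+ j)).
rewrite big_mkord; apply: eq_bigr => l _.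
rewrite e2 e3 polyM2M !coefMn coef_polyM2 -scalerAr coefZ.
have lN : (l <= N)%N by rewrite -ltnS.
rewrite !(coef_shift_exp _ _ _ _ lN).
rewrite !coef_1BX2_exp_diag; case: (boolP (odd l)) => ol; first by rewrite !mulr0 mul0rn.
set j := l./2; have -> : (l : nat) = (2 * j)%N by rewrite /j; lia.
rewrite exprM; have -> : d ^+ 2 = 16^-1.
  rewrite -dE sqrrN; have -> : 16 = 4 ^+ 2 :> F by rewrite -natrX.
  by rewrite exprVn.
have -> (x y z : F) : x * (y * z) * (y * z) = (y * y) * (x * z ^+ 2) by ring.
by rewrite -expr2 sqrr_sign -mulr_natl; ring.
Qed.

(** Both sides are the coefficient of t^m z^N in the N-th power of z(1 - t)^2 + (1 + z)^2 t = (z +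
    t)(1 + zt). On the left, [j] is the exponent of the second summand. *)
Lemma bin_sum_eq_sqr (R : comNzRingType) N m : (m <= N)%N ->
  \sum_(0 <= j < m.+1) 'C(N, j)%:R * 'C(2 * j, j)%:R *
     ((-1) ^+ (m - j) * 'C(2 * (N - j), m - j)%:R) =
  (if odd m then 0 else 'C(N, m./2)%:R ^+ 2) :> R.
Proof.
move=> mN.
pose z := polyM2 'X 1 : {poly {poly R}}; pose t := polyM2 1 'X : {poly {poly R}}.
pose zt := polyM2 'X 'X : {poly {poly R}}.
pose a := polyM2 'X ((1 - 'X) ^+ 2) : {poly {poly R}}.
pose b := polyM2 ((1 + 'X) ^+ 2) 'X : {poly {poly R}}.
have prodE : a + b = (z + t) * (1 + zt).
  rewrite /a /b /z /t /zt /polyM2.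
  rewrite !(rmorphD, rmorphB, rmorphN, rmorphM, rmorphXn, rmorph1) /= map_polyX.
  by ring.
have := congr1 (fun P : {poly {poly R}} => (P ^+ N)`_m`_N) prodE.
rewrite exprMn !exprDn mulr_suml !coef_sum => E.
transitivity (\sum_(i < N.+1) (a ^+ (N - i) * b ^+ i *+ 'C(N, i))`_m`_N).
  rewrite big_mkord (big_ord_widen N.+1 (fun j => 'C(N, j)%:R * 'C(2 * j, j)%:R *
    ((-1) ^+ (m - j) * 'C(2 * (N - j), m - j)%:R))) ?ltnS // big_mkcond.
  apply: eq_bigr => i _; have iN : (i <= N)%N by rewrite -ltnS.
  rewrite !polyM2X polyM2M !coefMn coef_polyM2 (coef_shift_exp _ _ _ _ iN).
  rewrite -!exprM coef_1DX_exp coefMXn coef_1BX_exp ltnS ltnNge.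
  by case: leqP => im /=; rewrite ?mulr0 ?mul0rn // -mulr_natl; ring.
rewrite E => {E}.
transitivity (\sum_(i < N.+1) (if (2 * i == m)%N then 'C(N, i)%:R ^+ 2 else 0 : R)).
  apply: eq_bigr => i _; have iN : (i <= N)%N by rewrite -ltnS.
  (* The terms t^i z^(N-i) and (zt)^j give z^N only for j = i, and the power of [t] is then 2i. *)
  rewrite mulr_sumr !coef_sum (bigD1 i) //= big1 ?addr0.
    rewrite expr1n mul1r mulrnAl [in LHS]mulrnAr !coefMn !polyM2X !polyM2M coef_polyM2.
    rewrite !expr1n !mulr1 mul1r -!exprD subnK // !coefXn eqxx addnn -mul2n eq_sym.
    by case: ifP => _; rewrite ?mulr0 ?mul0rn // mulr1 -mulrnA natrM expr2.
  move=> j ji.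
  rewrite expr1n mul1r mulrnAl [in LHS]mulrnAr !coefMn !polyM2X !polyM2M coef_polyM2.
  rewrite !expr1n !mulr1 mul1r -!exprD !coefXn.
  have -> : (N == N - i + j)%N = false.
    by apply/negP => /eqP h; move/negP: ji; apply; apply/eqP/val_inj => /=; lia.
  by rewrite mul0r !mul0rn.
case: (boolP (odd m)) => om.
  by rewrite big1 // => i _; case: eqP => // h; move: om; rewrite -h mul2n odd_double.
have kN : (m./2 < N.+1)%N by lia.
rewrite (bigD1 (Ordinal kN)) //= big1 ?addr0 => [|i ik].
  by rewrite ifT //; lia.
rewrite ifN //; apply: contraNN ik => /eqP h; apply/eqP/val_inj => /=; lia.
Qed.

(** * The sum modulo p *)

Lemma sum_triangle (V : nmodType) (f : nat -> nat -> V) n :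
  \sum_(0 <= k < n) \sum_(0 <= i < k.+1) f i (k - i)%N =
  \sum_(0 <= i < n) \sum_(0 <= j < n - i) f i j.
Proof.
elim: n => [|n IHn]; first by rewrite !big_geq.
rewrite big_nat_recr //= IHn [in RHS]big_nat_recr //= subSnn big_nat1.
rewrite [X in _ + X]big_nat_recr //= subnn addrA -big_split /=; congr (_ + _).
by apply: eq_big_nat => i /andP[_ ilt]; rewrite subSn 1?ltnW // big_nat_recr.
Qed.

Lemma domb_sum_pchar (F : fieldType) (p : nat) : p \in [pchar F] -> odd p ->
  \sum_(0 <= n < p) (A n)%:R / 8 ^+ n =
  (if odd (p %/ 4) then 0 else 'C(p./2, p %/ 8)%:R ^+ 2) :> F.
Proof.
move=> pF p_odd; set N := p./2; set m := (p %/ 4)%N.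
have n2 := two_neq0 F p pF p_odd; have n4 := four_neq0 F p pF p_odd.
have n8 : 8 != 0 :> F by rewrite (natrM F 2 4) mulf_neq0.
have n16 : 16 != 0 :> F by rewrite (natrM F 4 4) mulf_neq0.
pose f i j : F := 'C(N, i)%:R * 'C(N, j)%:R * 'C(i + j, j)%:R ^+ 2 * (- 2^-1) ^+ (i + j).
have -> : \sum_(0 <= n < p) (A n)%:R / 8 ^+ n =
    \sum_(0 <= n < p) \sum_(0 <= i < n.+1) f i (n - i)%N.
  apply: eq_big_nat => n /andP[_ np].
  rewrite /A natr_sum mulr_suml; apply: eq_big_nat => i /andP[_ ni].
  have le_in : (i <= n)%N by rewrite -ltnS.
  rewrite /f (subnKC le_in) (bin_sub le_in).
  have -> : (2 * n - 2 * i = 2 * (n - i))%N by lia.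
  rewrite !natrM !(central_bin_half F p pF p_odd); try lia.
  have -> : - 2^-1 = -4 / 8 :> F by field; rewrite n2 n8.
  have -> : (-4 / 8) ^+ n = (-4) ^+ i * (-4) ^+ (n - i) / 8 ^+ n :> F.
    by rewrite -exprD (subnKC le_in) exprMn exprVn.
  by ring.
rewrite sum_triangle.
(* Since 2N < p, the square i, j <= N lies inside the triangle i + j < p, and [f] vanishes outside
   the square. *)
have f0 i j : (N < i)%N || (N < j)%N -> f i j = 0.
  by rewrite /f => /orP[] h; rewrite (bin_small h) ?mulr0 ?mul0r.
rewrite (big_cat_nat (n := N.+1)) //=; last by lia.
rewrite [X in _ + X]big_nat_cond [X in _ + X]big1 ?addr0; last first.
  by move=> i; rewrite andbT => /andP[Ni _]; rewrite big1 // => j _; rewrite f0 // Ni.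
transitivity (\sum_(0 <= i < N.+1) \sum_(0 <= j < N.+1) f i j).
  apply: eq_big_nat => i /andP[_ iN].
  rewrite (big_cat_nat (n := N.+1)) //=; last by lia.
  rewrite [X in _ + X]big_nat_cond [X in _ + X]big1 ?addr0 // => j.
  by rewrite andbT => /andP[Nj _]; rewrite f0 // Nj orbT.
rewrite double_sum_bin //.
have -> : (p %/ 8 = m./2)%N by rewrite /m; lia.
rewrite -bin_sum_eq_sqr; last by rewrite /m /N; lia.
have -> : uphalf N.+1 = m.+1 by rewrite /m /N; lia.
apply: eq_big_nat => j /andP[_ jm].
have jp : (2 * j < p)%N by move: jm; rewrite /m; lia.
(* The two sums agree term by term: upper negation turns the signed binomial into 'C(m + j, 2j),
   which is 'C(N, 2j) up to a power of -4. *)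
have -> : (2 * (N - j) = p.-1 - 2 * j)%N by rewrite /N; lia.
have mp : (2 * j + (m - j) < p)%N by move: jm jp; rewrite /m; lia.
rewrite (bin_pred_pchar F p pF) // (bin_half_quarter F p pF p_odd) // -/m.
have -> : (2 * j + (m - j) = m + j)%N by lia.
have -> : 'C(m + j, m - j) = 'C(m + j, 2 * j).
  have le : (m - j <= m + j)%N by lia.
  by rewrite -(bin_sub le); congr ('C(_, _)); lia.
rewrite [X in X ^+ 2](central_bin_half F p pF p_odd);
  rewrite ?[in RHS](central_bin_half F p pF p_odd) -/N; try lia.
have e : ((-4) ^+ j) ^+ 2 * 16^-1 ^+ j = 1 :> F.
  rewrite -exprM mulnC exprM -exprMn; have -> : (-4) ^+ 2 = 16 :> F by rewrite sqrrN -natrX.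
  by rewrite mulfV // expr1n.
move: e; move: ((-4) ^+ j) (16^-1 ^+ j) => u v e.
transitivity (u ^+ 2 * v * (u * 'C(m + j, 2 * j)%:R * 'C(N, j)%:R ^+ 2)); first by ring.
by rewrite e; ring.
Qed.

(** * Sums over the prime subfield *)

Lemma exists_exp_neq1 (K : finFieldType) (T : {set K}) n :
  (0 < n < #|T|)%N -> exists2 x, x \in T & x ^+ n != 1.
Proof.
case/andP=> n0 nT; apply/exists_inP; apply: contraTT nT.
rewrite negb_exists_in -leqNgt => /forall_inP h.
have := @max_poly_roots _ ('X^n - 1) (enum T).
rewrite size_XnsubC // ltnS cardE; apply; rewrite ?enum_uniq //.
  by rewrite -size_poly_eq0 size_XnsubC.
apply/allP => x; rewrite mem_enum => /h; rewrite negbK => /eqP xn.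
by rewrite /root !hornerE xn subrr.
Qed.

Lemma exists_exp_eqN1 (K : finFieldType) (T : {set K}) n :
  (0 < n < #|T|)%N -> (forall x, x \in T -> x ^+ (2 * n) = 1) ->
  exists2 x, x \in T & x ^+ n = -1.
Proof.
move=> /exists_exp_neq1[x xT xn] T1; exists x => //.
have /eqP := T1 x xT; rewrite mulnC exprM sqrf_eq1 (negbTE xn) /=; exact/eqP.
Qed.

Section PrimeSubfield.
Variables (K : finFieldType) (p : nat).
Hypothesis pK : p \in [pchar K].
Let p_prime : prime p. Proof. by case/andP: pK. Qed.
Let p_gt0 : (0 < p)%N. Proof. exact: prime_gt0. Qed.

(** The prime field inside [K], as the fixed points of Frobenius: membership is an equation, and
    closure under the field operations is immediate. *)
Definition primesub : {set K} := [set x | x ^+ p == x].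
Local Notation Fp := primesub.

Lemma primesubP x : reflect (x ^+ p = x) (x \in Fp).
Proof. by rewrite inE; apply: eqP. Qed.

Lemma exprpD (x y : K) : (x + y) ^+ p = x ^+ p + y ^+ p.
Proof. by rewrite -!(pFrobenius_autE pK) rmorphD. Qed.

Lemma exprpN (x : K) : (- x) ^+ p = - x ^+ p.
Proof. by rewrite -!(pFrobenius_autE pK) rmorphN. Qed.

Lemma primesub_add x y : x \in Fp -> y \in Fp -> x + y \in Fp.
Proof. by move=> /primesubP hx /primesubP hy; apply/primesubP; rewrite exprpD hx hy. Qed.

Lemma primesub_opp x : x \in Fp -> - x \in Fp.
Proof. by move=> /primesubP hx; apply/primesubP; rewrite exprpN hx. Qed.

Lemma primesub_mul x y : x \in Fp -> y \in Fp -> x * y \in Fp.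
Proof. by move=> /primesubP hx /primesubP hy; apply/primesubP; rewrite exprMn hx hy. Qed.

Lemma primesub_inv x : x \in Fp -> x^-1 \in Fp.
Proof. by move=> /primesubP hx; apply/primesubP; rewrite exprVn hx. Qed.

Lemma primesub_nat n : n%:R \in Fp.
Proof. by apply/primesubP; rewrite -(pFrobenius_autE pK) pFrobenius_aut_nat. Qed.

Lemma primesub_expp1 x : x \in Fp -> x != 0 -> x ^+ p.-1 = 1.
Proof.
by move=> /primesubP hx x0; apply: (mulfI x0); rewrite -exprS prednK // mulr1.
Qed.

(** At most [p] elements, as roots of X^p - X; at least [p], as 0, ..., p - 1 have distinct
    images. *)
Lemma card_primesub : #|Fp| = p.
Proof.
apply/eqP; rewrite eqn_leq; apply/andP; split.
  have s : size ('X^p - 'X : {poly K}) = p.+1.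
    by rewrite size_polyDl size_polyXn // size_polyN size_polyX ltnS prime_gt1.
  have := @max_poly_roots _ ('X^p - 'X : {poly K}) (enum Fp).
  rewrite s ltnS cardE; apply; rewrite ?enum_uniq //; first by rewrite -size_poly_eq0 s.
  apply/allP => x; rewrite mem_enum => /primesubP xn.
  by rewrite /root !hornerE xn subrr.
have inj : injective (fun i : 'I_p => (i : nat)%:R : K).
  suff H (i j : 'I_p) : (i <= j)%N -> i%:R = j%:R :> K -> i = j.
    by move=> i j h; case: (leqP i j) => ij; [exact: H | apply/esym/H => //; exact: ltnW].
  move=> ij /esym/eqP; rewrite -subr_eq0 -natrB // -(dvdn_pcharf pK) => d.
  apply/val_inj => /=; case: (posnP (j - i)) => [|/dvdn_leq/(_ d)].
    by move/eqP; rewrite subn_eq0 => ji; apply/eqP; rewrite eqn_leq ij.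
  by rewrite leqNgt (leq_ltn_trans (leq_subr _ _)).
rewrite -[X in (X <= _)%N]card_ord -(card_imset _ inj); apply: subset_leq_card.
by apply/subsetP => _ /imsetP[i _ ->]; apply: primesub_nat.
Qed.

(** Scaling by an element with c^m != 1 multiplies the sum by c^m, so it vanishes; m = 0 gives [p]
    ones. Below 2(p - 1), only m = p - 1 leaves a nonzero sum. *)
Lemma sum_primesub_exp m : (m < 2 * p.-1)%N ->
  \sum_(x in Fp) x ^+ m = if m == p.-1 then -1 else 0.
Proof.
have sum1 : p.-1%:R = -1 :> K.
  by apply/eqP; rewrite -subr_eq0 opprK -[1]/(1%:R) -natrD addn1 prednK ?pcharf0.
have Fp0 : 0 \in Fp by apply: (primesub_nat 0).
have card0 : #|Fp :\ 0| = p.-1.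
  by move: (cardsD1 0 Fp); rewrite Fp0 card_primesub add1n => ->.
have small k : (0 < k < p.-1)%N -> \sum_(x in Fp) x ^+ k = 0.
  move=> kp; have [c cF ck] : exists2 c, c \in Fp :\ 0 & c ^+ k != 1.
    by apply: exists_exp_neq1; rewrite card0.
  case/setD1P: cF => c0 cF.
  have : \sum_(x in Fp) x ^+ k = c ^+ k * \sum_(x in Fp) x ^+ k.
    rewrite {1}(reindex_inj (mulfI c0)) mulr_sumr /=; apply: eq_big => x; last by rewrite exprMn.
    apply/idP/idP => [xc|]; last exact: primesub_mul.
    by rewrite -(mulKf c0 x) primesub_mul ?primesub_inv.
  move/eqP; rewrite -subr_eq0 -{1}[\sum_(_ in _) _]mul1r -mulrBl mulf_eq0 subr_eq0.
  by rewrite eq_sym (negbTE ck) => /eqP.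
move=> mp; case: (ltngtP m p.-1) => [mlt|mgt|->].
- case: m => [|m] in mp mlt *; last by apply: small.
  by rewrite sumr_const card_primesub pcharf0.
- transitivity (\sum_(x in Fp) x ^+ (m - p.-1)); last by apply: small; lia.
  apply: eq_bigr => x /primesubP xp.
  have -> : m = (p + (m - p.-1).-1)%N by lia.
  by rewrite exprD xp -exprS; congr (_ ^+ _); lia.
rewrite (big_setD1 0) //= expr0n.
have -> : (p.-1 == 0)%N = false by have := prime_gt1 p_prime; lia.
rewrite add0r -sum1 (eq_bigr (fun=> 1)) => [|x /setD1P[x0 xF]]; last exact: primesub_expp1.
by rewrite sumr_const card0.
Qed.

(** The falling factorial of [l] of length p - 1 contains the factor [p], while (p - 1)! is prime to
    [p]. *)
Lemma bin_pred_prime l : (p <= l < 2 * p.-1)%N -> (p %| 'C(l, p.-1))%N.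
Proof.
move=> /andP[pl l2]; have := bin_ffact l p.-1 => e.
have d : (p %| l ^_ p.-1)%N.
  rewrite ffact_prod; have h : (l - p < p.-1)%N by lia.
  by rewrite (bigD1 (Ordinal h)) //= subKn // dvdn_mulr.
have nfact n : (n < p)%N -> ~~ (p %| n`!)%N.
  elim: n => [|n IHn] np; first by rewrite dvdn1 gtn_eqF ?prime_gt1.
  by rewrite factS Euclid_dvdM // gtnNdvd //= IHn // ltnW.
by move: d; rewrite -e Euclid_dvdM // (negbTE (nfact _ _)) ?orbF // prednK.
Qed.

(** Only t^(p-1) has a nonzero sum. In (al + be t)^l it carries 'C(l, p - 1), which vanishes in [K]
    unless l = p - 1. *)
Lemma sum_primesub_affine (h : {poly K}) (al be : K) : (size h <= 2 * p.-1)%N ->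
  \sum_(t in Fp) h.[al + be * t] = - be ^+ p.-1 * h`_p.-1.
Proof.
move=> sh.
have pow l : (l < 2 * p.-1)%N ->
    \sum_(t in Fp) (al + be * t) ^+ l = if l == p.-1 then - be ^+ p.-1 else 0.
  move=> lp.
  transitivity (\sum_(i < l.+1) al ^+ (l - i) * be ^+ i *+ 'C(l, i) * \sum_(t in Fp) t ^+ i).
    under eq_bigr do rewrite exprDn; rewrite exchange_big; apply: eq_bigr => i _.
    by rewrite mulr_sumr; apply: eq_bigr => t _; rewrite exprMn mulrA mulrnAl.
  transitivity (\sum_(i < l.+1)
      if (i : nat) == p.-1 then - (al ^+ (l - i) * be ^+ i *+ 'C(l, i)) else 0).
    apply: eq_bigr => i _; rewrite sum_primesub_exp; last by have := ltn_ord i; lia.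
    by case: ifP => _; rewrite ?mulr0 ?mulrN1.
  case: (ltngtP l p.-1) => [llt|lgt|->].
  - by rewrite big1 // => i _; rewrite ifN // ltn_eqF // (leq_trans _ llt) ?ltn_ord.
  - rewrite big1 // => i _; case: eqP => // ->.
    rewrite -mulr_natr; have /eqP -> : 'C(l, p.-1)%:R == 0 :> K; last by rewrite mulr0 oppr0.
    by rewrite -(dvdn_pcharf pK) bin_pred_prime //; lia.
  rewrite (bigD1 ord_max) //= eqxx big1 ?addr0 => [|i ni].
    by rewrite subnn expr0 mul1r binn mulr1n.
  by rewrite ifN //; apply: contraNN ni => /eqP h'; apply/eqP/val_inj.
transitivity (\sum_(l < size h) h`_l * (if (l : nat) == p.-1 then - be ^+ p.-1 else 0)).
  under eq_bigr do rewrite horner_coef; rewrite exchange_big; apply: eq_bigr => l _.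
  by rewrite -mulr_sumr pow //; apply: leq_trans sh.
case: (ltnP p.-1 (size h)) => hs.
  rewrite (bigD1 (Ordinal hs)) //= eqxx mulrC big1 ?addr0 // => i ni.
  by rewrite ifN ?mulr0 //; apply: contraNN ni => /eqP h'; apply/eqP/val_inj.
rewrite [h`_p.-1]nth_default // mulr0 big1 // => i _.
by rewrite ifN ?mulr0 // ltn_eqF // (leq_trans _ hs) ?ltn_ord.
Qed.

Hypothesis p_odd : odd p.

(** A finite beta integral: x = (1 + t i)/2 turns the summand into 2^(a+b) x^a (1 - x)^b, and the
    last factor is the coefficient of x^(p-1) in x^a (1 - x)^b. *)
Lemma sum_primesub_beta (i : K) a b : (a + b < 2 * p.-1)%N -> (a <= p.-1)%N ->
  \sum_(t in Fp) (1 + t * i) ^+ a * (1 - t * i) ^+ b =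
  - 2 ^+ (a + b) * (i / 2) ^+ p.-1 * ((-1) ^+ (p.-1 - a) * 'C(b, p.-1 - a)%:R).
Proof.
move=> ab ap; pose h : {poly K} := 'X^a * (1 - 'X) ^+ b.
have n2 : 2 != 0 :> K := two_neq0 K p pK p_odd.
have sX1 : size (1 - 'X : {poly K}) = 2 by rewrite -size_polyN opprB size_XsubC.
have sh : (size h <= 2 * p.-1)%N.
  have nX1 : 1 - 'X != 0 :> {poly K} by rewrite -size_poly_eq0 sX1.
  rewrite /h mulrC size_mulXn ?expf_neq0 //.
  by rewrite -[size _]prednK ?lt0n ?size_poly_eq0 ?expf_neq0 // size_exp sX1; lia.
have := sum_primesub_affine h (2^-1) (i / 2) sh.
rewrite coefXnM ltnNge ap /= coef_1BX_exp => E.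
transitivity (2 ^+ (a + b) * \sum_(t in Fp) h.[2^-1 + i / 2 * t]); last by rewrite E; ring.
rewrite mulr_sumr; apply: eq_bigr => t _.
rewrite !hornerE exprD /= -mulrA mulrACA -!exprMn; congr (_ ^+ _ * _ ^+ _); field => //.
Qed.

Lemma sum_primesub_beta0 (i : K) a b : (a + b < p.-1)%N ->
  \sum_(t in Fp) (1 + t * i) ^+ a * (1 - t * i) ^+ b = 0.
Proof.
by move=> ab; rewrite sum_primesub_beta ?bin_small ?mulr0 //; lia.
Qed.

(** The beta sum yields 'C(p - 1 - b, a), which is 'C(a + b, b) up to sign by upper negation.
    Squaring removes the sign and the powers of i and 2, the exponent of 2 becoming 3(p - 1). *)
Lemma sum_primesub_beta_sqr (i : K) a b : i ^+ 2 = -1 -> (a + b)%N = p./2 ->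
  (\sum_(t in Fp) (1 + t * i) ^+ (p.-1 - a) * (1 - t * i) ^+ (p.-1 - b)) ^+ 2 =
  'C(p./2, b)%:R ^+ 2.
Proof.
move=> i2 ab; have p1 := prime_gt1 p_prime.
have n2 : 2 != 0 :> K := two_neq0 K p pK p_odd.
rewrite sum_primesub_beta; try lia.
have -> : (p.-1 - (p.-1 - a) = a)%N by lia.
have e : (-1) ^+ a * 'C(p.-1 - b, a)%:R = 'C(p./2, b)%:R :> K.
  rewrite (bin_pred_pchar K p pK) //; last by lia.
  by rewrite -ab addnC -[in RHS]bin_sub ?leq_addl // addnK.
have h1 : 2 ^+ p.-1 = 1 :> K by rewrite primesub_expp1 ?primesub_nat.
have h2 : (i ^+ p.-1) ^+ 2 = 1.
  by rewrite exprAC i2 -signr_odd; have -> : odd p.-1 = false by lia.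
have h3 : (2 ^+ (p.-1 - a + (p.-1 - b))) ^+ 2 = 1 :> K.
  rewrite -exprM; have -> : ((p.-1 - a + (p.-1 - b)) * 2 = p.-1 * 3)%N by lia.
  by rewrite exprM h1 expr1n.
by rewrite e !exprMn sqrrN exprVn h1 invr1 expr1n h2 h3 !mulr1 !mul1r.
Qed.

End PrimeSubfield.

(** * Eighth roots of unity *)

Section EighthRoots.
Variables (K : finFieldType) (w : K).
Hypothesis w4 : w ^+ 4 = -1.
Hypothesis n2 : 2 != 0 :> K.

Lemma prim8 : 8.-primitive_root w.
Proof.
have n1 : -1 != 1 :> K by rewrite -subr_eq0 -opprD oppr_eq0.
have w8 : w ^+ 8 = 1 by rewrite (exprM w 4 2) w4 sqrrN expr1n.
have [m pm md] := prim_order_exists (isT : 0 < 8)%N w8.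
have m4 : (m %| 4)%N = false by rewrite (prim_order_dvd pm) w4; apply: negbTE.
have m8 := dvdn_leq (isT : 0 < 8)%N md.
suff <- : m = 8%N by [].
by move: m4 md m8 {pm}; do 9 (case: m => [|m] //).
Qed.

(* [coord8 c x] is the coefficient of [zeta^c] in the lift of [x] to
   [Z[zeta_8]], for the basis [1, zeta, zeta^2, zeta^3], and [sgn1 x] is the
   coefficient of [1]; both are [0] when [x = 0] or [x] is not a root of unity. *)
Definition sgn1 (x : K) : int := (x == 1)%:R - (x == -1)%:R.
Definition coord8 (c : nat) (x : K) : int := sgn1 (x * w ^+ (8 - c)).

Lemma sgn1_exp n : sgn1 (w ^+ n) = ((n %% 8 == 0)%N%:R - (n %% 8 == 4)%N%:R).
Proof.
by rewrite /sgn1 -(prim_order_dvd prim8) -w4 (eq_prim_root_expr prim8).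
Qed.

Lemma sgn1N x : sgn1 (- x) = - sgn1 x.
Proof. by rewrite /sgn1 opprB eqr_opp eqr_oppLR. Qed.

Lemma sgn1_0 : sgn1 0 = 0.
Proof. by rewrite /sgn1 eq_sym oner_eq0 eq_sym oppr_eq0 oner_eq0. Qed.

Lemma sgn1_1 : sgn1 1 = 1.
Proof. by rewrite /sgn1 eqxx -addr_eq0 (negbTE n2) subr0. Qed.

Lemma coord8_0 c : coord8 c 0 = 0.
Proof. by rewrite /coord8 mul0r sgn1_0. Qed.

Definition root8 (x : K) := (x == 0) || (x ^+ 8 == 1).

Lemma root8P x : root8 x -> x = 0 \/ exists2 e : nat, (e < 8)%N & x = w ^+ e.
Proof.
by case/orP => [/eqP | /eqP /(prim_rootP prim8)[e ->]]; [left | right; exists e].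
Qed.

(** For nonzero [y], [y ^+ 7] is the inverse, which lifts to the complex conjugate. The constant
    coefficient of a lift times a conjugate is the dot product of the coordinates. *)
Lemma sgn1_ratio x y : root8 x -> root8 y ->
  sgn1 (x * y ^+ 7) = \sum_(c < 4) coord8 c x * coord8 c y.
Proof.
move=> /root8P[->|[a a8 ->]].
  by rewrite mul0r sgn1_0 big1 // => c _; rewrite coord8_0 mul0r.
move=> /root8P[->|[b b8 ->]].
  by rewrite expr0n mulr0 sgn1_0 big1 // => c _; rewrite coord8_0 mulr0.
rewrite !big_ord_recr big_ord0 /= add0r /coord8 -exprM -!exprD !sgn1_exp.
by do 8 (case: a a8 => [|a] a8 //; do 8?[case: b b8 => [|b] b8 //]).
Qed.

(** On lifts, cubing is the automorphism zeta -> zeta^3, whose fixed field is generated by zeta +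
    zeta^3 = sqrt(-2). *)
Lemma coord8_cube x : root8 x ->
  [/\ coord8 0 (x ^+ 3) = coord8 0 x, coord8 1 (x ^+ 3) = coord8 3 x &
      coord8 2 (x ^+ 3) = - coord8 2 x].
Proof.
move=> /root8P[->|[a a8 ->]]; first by rewrite expr0n /= !coord8_0 oppr0.
rewrite /coord8 -!exprM -!exprD !sgn1_exp.
by do 8 (case: a a8 => [|a] a8 //).
Qed.

Lemma root8_coord x : root8 x ->
  x = \sum_(c < 4) (coord8 c x)%:~R * w ^+ c.
Proof.
move=> /root8P[->|[a a8 ->]].
  by rewrite big1 // => c _; rewrite coord8_0 mul0r.
rewrite !big_ord_recr big_ord0 /= add0r /coord8 -!exprD !sgn1_exp.
have w5 k : w ^+ (4 + k) = - w ^+ k by rewrite exprD w4 mulN1r.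
by do 8 (case: a a8 => [|a] a8 //; first by rewrite /= ?(w5 0) ?(w5 1) ?(w5 2) ?(w5 3); ring).
Qed.

(** The reduction of the conjugate lift, by zeta^-1 = -zeta^3. *)
Lemma root8_inv_coord x : root8 x ->
  x ^+ 7 = (coord8 0 x)%:~R - (coord8 3 x)%:~R * w
    - (coord8 2 x)%:~R * w ^+ 2 - (coord8 1 x)%:~R * w ^+ 3.
Proof.
move=> /root8P[->|[a a8 ->]]; first by rewrite expr0n !coord8_0 !mul0r !subr0.
rewrite /coord8 -!exprM -!exprD !sgn1_exp.
have w5 k : w ^+ (4 + k) = - w ^+ k by rewrite exprD w4 mulN1r.
rewrite -(prim_expr_mod prim8 (a * 7)).
by do 8 (case: a a8 => [|a] a8 //; first by rewrite /= ?(w5 0) ?(w5 1) ?(w5 2) ?(w5 3); ring).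
Qed.

Variables (T : {set K}) (th : K -> K).
Hypothesis TN : forall t, t \in T -> - t \in T.
Hypothesis th_root8 : forall t, t \in T -> root8 (th t).
Hypothesis thN : forall t, t \in T -> th (- t) = th t ^+ 3.

(** Let J be the sum of the lifts of [th t]. Reindexing by t -> -t shows that J is fixed by zeta ->
    zeta^3, so J = a + b sqrt(-2). The double sum is the norm of J, and the other sum is the
    reduction of its trace. *)
Lemma second_moment : exists a b : int,
  \sum_(t in T) \sum_(s in T) sgn1 (th t * th s ^+ 7) = a ^+ 2 + 2 * b ^+ 2 /\
  \sum_(t in T) th t + \sum_(t in T) th t ^+ 7 = (2 * a)%:~R.
Proof.
pose V c : int := \sum_(t in T) coord8 c (th t).
have VN c : V c = \sum_(t in T) coord8 c (th t ^+ 3).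
  rewrite /V (reindex_inj oppr_inj) /=; apply: eq_big => t; last first.
    by move=> Nt; rewrite thN // -[t]opprK TN.
  by apply/idP/idP => h; [rewrite -[t]opprK|]; apply: TN.
have V2 : V 2 = 0.
  have : V 2 = - V 2.
    rewrite {1}VN -sumrN; apply: eq_bigr => t tT.
    by have [_ _ ->] := coord8_cube _ (th_root8 _ tT).
  by lia.
have V1 : V 1 = V 3.
  by rewrite VN; apply: eq_bigr => t tT; have [_ -> _] := coord8_cube _ (th_root8 _ tT).
exists (V 0), (V 1); split.
  transitivity (\sum_(c < 4) V c * V c).
    under eq_bigr => t tT do under eq_bigr => s sT do rewrite sgn1_ratio ?th_root8 //.
    under eq_bigr => t tT do rewrite exchange_big.
    rewrite exchange_big; apply: eq_bigr => c _.
    by rewrite mulr_suml; apply: eq_bigr => t _; rewrite mulr_sumr.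
  rewrite !big_ord_recr big_ord0 /= V2 -V1; ring.
have e1 : \sum_(t in T) th t = \sum_(c < 4) (V c)%:~R * w ^+ c.
  under eq_bigr => t tT do rewrite (root8_coord _ (th_root8 _ tT)).
  rewrite exchange_big; apply: eq_bigr => c _.
  by rewrite /V rmorph_sum mulr_suml.
have e2 : \sum_(t in T) th t ^+ 7 =
    (V 0)%:~R - (V 3)%:~R * w - (V 2)%:~R * w ^+ 2 - (V 1)%:~R * w ^+ 3.
  under eq_bigr => t tT do rewrite (root8_inv_coord _ (th_root8 _ tT)).
  by rewrite !sumrB -!mulr_suml -!rmorph_sum.
rewrite e1 e2 !big_ord_recr big_ord0 /= V2 -V1 rmorphM /=; ring.
Qed.

End EighthRoots.

(** * The norm of the character sum *)

Section OffDiagonal.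
Variable T : finType.

Definition offdiag (U : {set T}) : {set T * T} :=
  [set u | [&& u.1 \in U, u.2 \in U & u.2 != u.1]].

Lemma offdiagP (U : {set T}) t s :
  reflect [/\ t \in U, s \in U & t != s] ((t, s) \in offdiag U).
Proof. by rewrite inE /= [s == t]eq_sym; apply: and3P. Qed.

Lemma sum_offdiag (V : nmodType) (U : {set T}) (f : T -> T -> V) :
  \sum_(t in U) \sum_(s in U) f t s =
  \sum_(t in U) f t t + \sum_(u in offdiag U) f u.1 u.2.
Proof.
under eq_bigr => t tU do rewrite (bigD1 t) //=.
rewrite big_split /= pair_big_dep /=; congr (_ + _).
by apply: eq_bigl => u; rewrite inE.
Qed.

Lemma card_offdiag (U : {set T}) : #|offdiag U| = (#|U| * #|U|.-1)%N.
Proof.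
have := sum_offdiag _ U (fun _ _ => 1%N).
rewrite !sum1_card.
rewrite sum_nat_const; case: #|U| => [|n]; rewrite /= ?mulnS; lia.
Qed.

End OffDiagonal.

(** After cross-multiplication, the difference and the sum of the two equations give t - s = t' - s'
    and t s' = t' s; hence (t - s)(s' - s) = 0. *)
Lemma ratio_inj (K : fieldType) (i t s t' s' : K) : 2 != 0 :> K -> i ^+ 2 = -1 -> t != s ->
  1 + s * i != 0 -> 1 - s * i != 0 -> 1 + s' * i != 0 -> 1 - s' * i != 0 ->
  (1 + t * i) / (1 + s * i) = (1 + t' * i) / (1 + s' * i) ->
  (1 - t * i) / (1 - s * i) = (1 - t' * i) / (1 - s' * i) -> t = t' /\ s = s'.
Proof.
move=> n2 i2 ts h1 h2 h3 h4 /eqP; rewrite eqr_div // => /eqP e1.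
move=> /eqP; rewrite eqr_div // => /eqP e2.
have i0 : i != 0 by apply/eqP => i0; move/eqP: i2; rewrite i0 expr0n /= eq_sym oppr_eq0 oner_eq0.
have d : t - s = t' - s'.
  apply: (mulfI n2); apply: (mulfI i0).
  have : (1 + t * i) * (1 + s' * i) - (1 - t * i) * (1 - s' * i) =
    (1 + t' * i) * (1 + s * i) - (1 - t' * i) * (1 - s * i) by rewrite e1 e2.
  move=> e; apply/eqP; rewrite -subr_eq0; apply/eqP; move/eqP: e; rewrite -subr_eq0 => /eqP <-; ring.
have m : t * s' = t' * s.
  apply: (mulfI n2).
  have : (1 + t * i) * (1 + s' * i) + (1 - t * i) * (1 - s' * i) =
    (1 + t' * i) * (1 + s * i) + (1 - t' * i) * (1 - s * i) by rewrite e1 e2.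
  move=> e; apply/eqP; rewrite -subr_eq0; apply/eqP; move/eqP: e; rewrite -subr_eq0 => /eqP e.
  transitivity (- (2 * (t * s') * -1 - 2 * (t' * s) * -1)); first by ring.
  by rewrite -i2 -[RHS]oppr0 -e; ring.
have e : s = s'.
  apply/eqP; rewrite eq_sym -subr_eq0; have : (t - s) * (s' - s) = 0.
    have -> : (t - s) * (s' - s) = t * s' - t' * s - s * (t - s - (t' - s')) by ring.
    by rewrite m d !subrr mulr0 subrr.
  by move/eqP; rewrite mulf_eq0 !subr_eq0 (negbTE ts).
by split=> //; move: d; rewrite e => /addIr.
Qed.

Lemma ratio_neq (K : fieldType) (i t s : K) : 2 != 0 :> K -> i != 0 -> t != s ->
  1 + s * i != 0 -> 1 - s * i != 0 ->
  (1 + t * i) / (1 + s * i) != (1 - t * i) / (1 - s * i).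
Proof.
move=> n2 i0 ts h1 h2; rewrite eqr_div // -subr_eq0.
have -> : (1 + t * i) * (1 - s * i) - (1 - t * i) * (1 + s * i) = 2 * (i * (t - s)) by ring.
by rewrite !mulf_neq0 ?subr_eq0.
Qed.

Lemma sgn1_sum0 (K : finFieldType) (T : {set K}) (k : K) (f : K -> K) :
  k != 0 -> (forall x, (k * x \in T) = (x \in T)) -> (forall x, x \in T -> f (k * x) = - f x) ->
  \sum_(x in T) sgn1 K (f x) = 0.
Proof.
move=> k0 kT fN.
have : \sum_(x in T) sgn1 K (f x) = - \sum_(x in T) sgn1 K (f x).
  rewrite {1}(reindex_inj (mulfI k0)) -sumrN; apply: eq_big => x //.
  by rewrite kT => xT; rewrite fN // sgn1N.
lia.
Qed.

(** * From the second moment to the norm form *)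

Section Beta.
Variables (K : finFieldType) (p : nat) (w : K) (a b : nat).
Hypothesis pK : p \in [pchar K].
Hypothesis p_odd : odd p.
Hypothesis w4 : w ^+ 4 = -1.
Hypothesis ab : (a + b)%N = p./2.
Let p_prime : prime p. Proof. by case/andP: pK. Qed.
Let n2 : 2 != 0 :> K := two_neq0 K p pK p_odd.
Local Notation i := (w ^+ 2).
Local Notation Fp := (primesub K p).

(** For p = 8k + 1 the exponents will be 3k and k, giving chi^3(1 + t i) chi(1 - t i) with chi(x) =
    x^k. For p = 8k + 3 they will be 3k + 1 and k, giving chi(1 + t i) for a character chi of order
    8 of the field with p^2 elements. *)
Definition theta (t : K) := (1 + t * i) ^+ a * (1 - t * i) ^+ b.

Hypothesis theta_root8 : forall t, t \in Fp -> root8 K (theta t).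
Hypothesis thetaN : forall t, t \in Fp -> theta (- t) = theta t ^+ 3.
(** Ensures that [theta] vanishes wherever one of its bases does. It is conditional because b = 0
    for p = 3, where neither base vanishes. *)
Hypothesis ab_small : forall t, t \in Fp ->
  (1 + t * i) * (1 - t * i) = 0 -> (0 < a)%N && (0 < b)%N.
Hypothesis moment : \sum_(t in Fp) \sum_(s in Fp) sgn1 K (theta t * theta s ^+ 7) = p%:Z.

Lemma norm_form_of_moment : exists x y : int,
  p%:Z = x ^+ 2 + 2 * y ^+ 2 /\ (p%:Z %| 4 * x ^+ 2 - 'C(p./2, b)%:Z ^+ 2)%Z.
Proof.
have p1 := prime_gt1 p_prime.
have [x [y [e1 e2]]] := second_moment K w w4 n2 Fp theta (@primesub_opp K p pK) theta_root8 thetaN.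
exists x, y; split; first by rewrite -moment e1.
rewrite (dvdz_pcharf pK) rmorphB subr_eq0.
have i2 : i ^+ 2 = -1 by rewrite -exprM.
have := sum_primesub_beta_sqr K p pK p_odd i a b i2 ab.
(* Where [theta t] is nonzero, both summands are its inverse: (1 + t i)(1 - t i) = 1 + t^2 is a
   nonzero element of the prime field, so its power p - 1 is 1. *)
have -> : \sum_(t in Fp) (1 + t * i) ^+ (p.-1 - a) * (1 - t * i) ^+ (p.-1 - b) =
    \sum_(t in Fp) theta t ^+ 7.
  apply: eq_bigr => t tF.
  have [n0|n0] := eqVneq ((1 + t * i) * (1 - t * i)) 0.
    have /andP[a0 b0] := ab_small t tF n0.
    move/eqP: n0; rewrite /theta mulf_eq0 => /orP[] /eqP ->.
      by rewrite !expr0n !gtn_eqF ?mul0r ?mulr0 ?expr0n //; lia.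
    by rewrite !expr0n !gtn_eqF ?mul0r ?mulr0 ?expr0n //; lia.
  have u0 : theta t != 0.
    by move: n0; rewrite /theta !mulf_eq0 !negb_or => /andP[? ?]; rewrite !expf_neq0.
  have u8 : theta t ^+ 8 = 1.
    by case/orP: (theta_root8 t tF); [rewrite (negbTE u0) | move/eqP].
  apply: (mulfI u0); rewrite -exprS u8 /theta mulrACA -!exprD !subnKC; try lia.
  rewrite -exprMn (primesub_expp1 K p pK) //.
  have -> : (1 + t * i) * (1 - t * i) = 1 - t * t * i ^+ 2 by ring.
  by rewrite i2 mulrN1 opprK primesub_add ?(primesub_nat K p pK 1) ?primesub_mul.
(* The degree a + b is below p - 1, so the sum of [theta] is 0 and the trace 2x is the sum of the
   inverses. *)
move: e2; rewrite sum_primesub_beta0 //; last by lia.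
rewrite add0r => ->; rewrite rmorphM exprMn /= => h.
by rewrite rmorphM !rmorphXn /= -h -natrX.
Qed.

End Beta.

Lemma expf_cardB1 (K : finFieldType) (x : K) : x != 0 -> x ^+ #|K|.-1 = 1.
Proof.
move=> x0; apply: (mulfI x0); rewrite -exprS prednK ?expf_card ?mulr1 //.
by apply/card_gt0P; exists 0.
Qed.

Lemma exists_nonresidue (K : finFieldType) n : (0 < n)%N -> #|K| = (2 * n).+1 ->
  exists2 x : K, x != 0 & x ^+ n = -1.
Proof.
move=> n0 cK; have c0 : #|[set: K] :\ 0| = (2 * n)%N.
  by have := cardsD1 0 [set: K]; rewrite cardsT cK inE => -[].
have [|x /setD1P[x0 _]|x /setD1P[x0 _] xn] := exists_exp_eqN1 K ([set: K] :\ 0) n.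
- by rewrite c0; lia.
- by rewrite -(expf_cardB1 K x x0) cK.
by exists x.
Qed.

Lemma exists_root_N1 (K : finFieldType) n : (0 < n)%N -> #|K| = (8 * n).+1 ->
  exists2 k : K, k != 0 & k ^+ n = -1.
Proof.
move=> n0 cK; have [|x x0 xn] := exists_nonresidue K (4 * n) ltac:(lia).
  by rewrite cK; lia.
by exists (x ^+ 4); rewrite ?expf_neq0 // -exprM.
Qed.

Lemma exists_root8 (K : finFieldType) n : (0 < n)%N -> #|K| = (8 * n).+1 ->
  exists w : K, w ^+ 4 = -1.
Proof.
move=> n0 cK; have [|x x0 xn] := exists_nonresidue K (4 * n) ltac:(lia).
  by rewrite cK; lia.
by exists (x ^+ n); rewrite -exprM mulnC.
Qed.

(** * The second moment for p = 8k + 1 *)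

Section Split.
Variables (K : finFieldType) (p k : nat).
Hypothesis pK : p \in [pchar K].
Hypothesis cK : #|K| = p.
Hypothesis pk : p = (8 * k).+1.
Hypothesis k0 : (0 < k)%N.

Let p_odd : odd p. Proof. by rewrite pk; lia. Qed.
Let n2 : 2 != 0 :> K := two_neq0 K p pK p_odd.

Lemma primesub_full x : x \in primesub K p.
Proof. by rewrite inE -{1}cK expf_card. Qed.

Lemma expf8 (x : K) : x != 0 -> x ^+ (8 * k) = 1.
Proof. by move=> x0; have := expf_cardB1 K x x0; rewrite cK pk. Qed.

Variable w : K.
Hypothesis w4 : w ^+ 4 = -1.
Local Notation th := (theta K w (3 * k) k).
Let i2 : (w ^+ 2) ^+ 2 = -1. Proof. by rewrite -exprM. Qed.

Lemma split_root8 t : root8 K (th t).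
Proof.
rewrite /root8 /theta; have [//|n0] := eqVneq ((1 + t * w ^+ 2) ^+ (3 * k) * (1 - t * w ^+ 2) ^+ k) 0.
move: n0; rewrite mulf_eq0 !expf_eq0 muln_gt0 k0 /= negb_or => /andP[h1 h2].
rewrite exprMn -!exprM.
have -> : (3 * k * 8 = 8 * k * 3)%N by lia.
rewrite exprM (mulnC k) !expf8 ?expr1n ?mulr1 ?eqxx ?orbT //.
Qed.

(** Cubing turns the exponents 3k, k into 9k, 3k, and 9k acts as k on all of [K], at 0 because k >
    0. *)
Lemma split_thetaN t : th (- t) = th t ^+ 3.
Proof.
have e x : x ^+ (9 * k) = x ^+ k :> K.
  have [->|x0] := eqVneq x 0; first by rewrite !expr0n !gtn_eqF ?muln_gt0 ?k0.
  by rewrite (_ : 9 * k = 8 * k + k)%N; [rewrite exprD expf8 ?mul1r | lia].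
rewrite /theta mulNr opprK exprMn -!exprM.
have -> : (3 * k * 3 = 9 * k)%N by lia.
by rewrite e mulrC mulnC.
Qed.

(** The diagonal contributes p - 2. The pair of ratios [f] carries the pairs t != s in [U]
    bijectively to the pairs x != y in [V], where the sum of [g] is 2: it is 1 over all pairs and -1
    over the diagonal. *)
Lemma split_moment :
  \sum_(t in primesub K p) \sum_(s in primesub K p) sgn1 K (th t * th s ^+ 7) = p%:Z.
Proof.
set i := w ^+ 2.
pose U : {set K} := ~: [set i; - i]; pose V : {set K} := ~: [set 0; 1].
pose g (x y : K) := sgn1 K (x ^+ (3 * k) * y ^+ k).
pose f (u : K * K) := ((1 + u.1 * i) / (1 + u.2 * i), (1 - u.1 * i) / (1 - u.2 * i)).
have i0 : i != 0.
  by apply/eqP => h; move/eqP: i2; rewrite -/i h expr0n eq_sym oppr_eq0 oner_eq0.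
have UP t : reflect (1 + t * i != 0 /\ 1 - t * i != 0) (t \in U).
  have e1 x : (1 + x * i == 0) = (x == i).
    by rewrite addrC addr_eq0 -i2 expr2 (inj_eq (mulIf i0)).
  have e2 : (1 - t * i == 0) = (t == - i) by rewrite -mulNr e1 eqr_oppLR.
  rewrite !inE negb_or -e1 -e2; exact: andP.
have thz t : t \notin U -> th t = 0.
  move/UP => h; apply/eqP; rewrite /theta mulf_eq0 !expf_eq0 muln_gt0 k0 /=.
  by apply/norP => -[? ?]; apply: h.
have g00 x : g x 0 = 0.
  by rewrite /g expr0n (gtn_eqF k0) mulr0 sgn1_0.
have g0x x : g 0 x = 0.
  by rewrite /g expr0n muln_eq0 (gtn_eqF k0) mul0r sgn1_0.
have g11 : g 1 1 = 1 by rewrite /g !expr1n mulr1 sgn1_1.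
(* Scaling either variable of [g] by [kk], or both by the nonresidue [rr], changes its sign, so the
   complete sums over [K] vanish. *)
have [kk kk0 kkn] := exists_root_N1 K k k0 ltac:(by rewrite cK).
have kk3 : kk ^+ (3 * k) = -1 by rewrite mulnC exprM kkn exprS sqrrN expr1n mulr1.
have [rr rr0 rrn] := exists_nonresidue K (4 * k) ltac:(lia) ltac:(rewrite cK; lia).
have sum0 c (h : K -> K) : c != 0 -> (forall x, h (c * x) = - h x) -> \sum_x sgn1 K (h x) = 0.
  move=> c0 hN; transitivity (\sum_(x in [set: K]) sgn1 K (h x)).
    by apply: eq_bigl => x; rewrite inE.
  by apply: (sgn1_sum0 _ _ c) => // x; rewrite ?inE.
have sumV (h : K -> int) : \sum_(x in V) h x = \sum_x h x - h 0 - h 1.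
  have -> : \sum_x h x = h 0 + (h 1 + \sum_(x | (x != 0) && (x != 1)) h x).
    by rewrite (bigD1 0) //=; congr (_ + _); rewrite (bigD1 1) ?oner_neq0.
  rewrite (eq_bigl (fun x : K => (x != 0) && (x != 1))) => [|x]; first by ring.
  by rewrite !inE negb_or.
have gV : \sum_(u in offdiag _ V) g u.1 u.2 = 2.
  have := sum_offdiag _ _ V g.
  have -> : \sum_(x in V) g x x = -1.
    rewrite sumV g00 g11 /g (sum0 rr) ?subr0 ?sub0r // => x.
    by rewrite -!exprD -mulSnr exprMn rrn mulN1r.
  have -> : \sum_(x in V) \sum_(y in V) g x y = 1.
    have row x : \sum_(y in V) g x y = - g x 1.
      rewrite sumV g00 subr0 /g (sum0 kk) ?sub0r // => y.
      by rewrite exprMn kkn mulN1r !mulrN.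
    under eq_bigr => x _ do rewrite row.
    rewrite sumrN sumV g0x g11 /g (sum0 kk) // => x.
    by rewrite exprMn kk3 mulN1r mulNr.
  by move=> e; apply: (addrI (-1)); rewrite -e.
transitivity (\sum_(t in U) \sum_(s in U) g (f (t, s)).1 (f (t, s)).2).
  rewrite (eq_bigl predT) => [|t]; last by rewrite primesub_full.
  rewrite [in RHS]big_mkcond; apply: eq_bigr => t _.
  case: (boolP (t \in U)) => tU; last first.
    by rewrite big1 // => s _; rewrite thz // mul0r sgn1_0.
  rewrite (eq_bigl predT) => [|s]; last by rewrite primesub_full.
  rewrite [in RHS]big_mkcond; apply: eq_bigr => s _.
  case: (boolP (s \in U)) => sU; last by rewrite (thz s) // expr0n mulr0 sgn1_0.
  have /UP[h1 h2] := sU; rewrite /g /f /= !expr_div_n [in RHS]mulrACA -invfM; congr (sgn1 K (_ * _)).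
  have s0 : th s != 0 by rewrite /theta mulf_neq0 // expf_neq0.
  apply: (mulfI s0); rewrite -exprS mulfV //.
  by case/orP: (split_root8 s); [rewrite (negbTE s0) | move/eqP].
rewrite (sum_offdiag _ _ _ (fun t s => g (f (t, s)).1 (f (t, s)).2)).
have -> : \sum_(t in U) g (f (t, t)).1 (f (t, t)).2 = #|U|%:Z.
  transitivity (\sum_(t in U) (1 : int)); last by rewrite sumr_const natz.
  by apply: eq_bigr => t /UP[h1 h2]; rewrite /f /= !divff.
have cU : #|U| = (p - 2)%N.
  rewrite cardsCs setCK cK cards2; have -> // : i != - i.
  by rewrite -subr_eq0 opprK -mulr2n -mulr_natl mulf_neq0.
have cV : #|V| = (p - 2)%N.
  by rewrite cardsCs setCK cK cards2 eq_sym oner_neq0.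
have finj : {in offdiag _ U &, injective f}.
  move=> [t s] [t' s'] /offdiagP[tU /UP[h1 h2] ts] /offdiagP[_ /UP[h3 h4] _] [e e'].
  by have [-> ->] := ratio_inj K i t s t' s' n2 i2 ts h1 h2 h3 h4 e e'.
have fim : f @: offdiag _ U = offdiag _ V.
  (* Injectivity and #|U| = #|V| reduce equality to an inclusion: the two ratios avoid 0 and 1 and
     are distinct. *)
  apply/eqP; rewrite eqEcard; apply/andP; split; last first.
    by rewrite card_in_imset // !card_offdiag cU cV.
  apply/subsetP => _ /imsetP[[t s] /offdiagP[/UP[h1 h2] /UP[h3 h4] ts] ->].
  apply/offdiagP; rewrite !inE !negb_or !mulf_neq0 ?invr_neq0 //=.
  split; last exact: ratio_neq.
    apply: contraNneq ts => /(congr1 ( *%R^~ (1 + s * i))).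
    by rewrite mulfVK // mul1r => /addrI/(mulIf i0) ->.
  apply: contraNneq ts => /(congr1 ( *%R^~ (1 - s * i))).
  by rewrite mulfVK // mul1r => /addrI/oppr_inj/(mulIf i0) ->.
have -> : \sum_(u in offdiag _ U) g (f (u.1, u.2)).1 (f (u.1, u.2)).2 =
    \sum_(x in offdiag _ V) g x.1 x.2.
  by rewrite -fim big_imset //=.
by rewrite gV cU; have := prime_gt1 (pcharf_prime pK); lia.
Qed.

End Split.

(** * The second moment for p = 8k + 3 *)

Section Inert.
Variables (K : finFieldType) (p k : nat).
Hypothesis pK : p \in [pchar K].
Hypothesis cK : #|K| = (p ^ 2)%N.
Hypothesis pk : p = (8 * k + 3)%N.

Let p_odd : odd p. Proof. by rewrite pk; lia. Qed.
Let n2 : 2 != 0 :> K := two_neq0 K p pK p_odd.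
(** This is (p^2 - 1)/8 in base [p]: since Frobenius sends 1 + t i to 1 - t i, the digits are the
    exponents of [theta]. *)
Let n := (3 * k + 1 + k * p)%N.

Let n_card : #|K| = (8 * n).+1. Proof. by rewrite cK /n pk; nia. Qed.

Variable w : K.
Hypothesis w4 : w ^+ 4 = -1.
Local Notation th := (theta K w (3 * k + 1) k).
Local Notation Fp := (primesub K p).
Local Notation i := (w ^+ 2).
Let i2 : (w ^+ 2) ^+ 2 = -1. Proof. by rewrite -exprM. Qed.

Lemma conj_i : i ^+ p = - i.
Proof.
have -> : p = (2 * (4 * k + 1) + 1)%N by rewrite pk; lia.
rewrite exprD expr1 exprM i2 -signr_odd; have -> : odd (4 * k + 1) by lia.
by rewrite expr1 mulN1r.
Qed.

Lemma conj_D t : t \in Fp -> (1 + t * i) ^+ p = 1 - t * i.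
Proof. by move=> /primesubP tp; rewrite (exprpD K p pK) expr1n exprMn tp conj_i mulrN. Qed.

Lemma conj_B t : t \in Fp -> (1 - t * i) ^+ p = 1 + t * i.
Proof. by move=> tF; rewrite -mulNr conj_D ?(primesub_opp K p pK) // mulNr opprK. Qed.

(** The two elements are conjugate, so they vanish together, but their sum is 2. *)
Lemma inert_neq0 t : t \in Fp -> (1 + t * i != 0) && (1 - t * i != 0).
Proof.
move=> tF; have p0 : (0 < p)%N by rewrite pk; lia.
rewrite -[X in _ && (X != 0)](conj_D t tF) expf_eq0 p0 /= andbb.
apply/eqP => h; move: n2; have -> : 2 = (1 + t * i) + (1 - t * i) :> K by ring.
by rewrite -(conj_D t tF) h expr0n (gtn_eqF p0) addr0 eqxx.
Qed.

Lemma inert_theta t : t \in Fp -> th t = (1 + t * i) ^+ n.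
Proof. by move=> tF; rewrite /theta /n (exprD _ (3 * k + 1)) (mulnC k) (exprM _ p) conj_D. Qed.

Lemma inert_theta8 t : t \in Fp -> th t ^+ 8 = 1.
Proof.
move=> tF; have /andP[h _] := inert_neq0 t tF.
by rewrite inert_theta // -exprM mulnC; have := expf_cardB1 K _ h; rewrite n_card.
Qed.

(** Frobenius replaces [t] by [- t] in [theta], and p = 3 modulo 8 while [th t ^+ 8 = 1]. *)
Lemma inert_thetaN t : t \in Fp -> th (- t) = th t ^+ 3.
Proof.
move=> tF; transitivity (th t ^+ p).
  rewrite /theta exprMn [_ ^+ (3 * k + 1) ^+ p]exprAC.
  by rewrite [_ ^+ k ^+ p]exprAC conj_D // conj_B // mulNr opprK.
by rewrite {1}pk exprD exprM inert_theta8 // expr1n mul1r.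
Qed.

(** The diagonal contributes [p]. The ratios (1 + t i)/(1 + s i) with t != s run once through the
    complement of the prime field, over which [G] sums to 0, as it does over [K] and over the prime
    field. *)
Lemma inert_moment :
  \sum_(t in Fp) \sum_(s in Fp) sgn1 K (th t * th s ^+ 7) = p%:Z.
Proof.
pose G (x : K) := sgn1 K (x ^+ n).
pose f (u : K * K) := (1 + u.1 * i) / (1 + u.2 * i).
have n0 : (0 < n)%N by rewrite /n; lia.
have th_ratio t s : t \in Fp -> s \in Fp -> sgn1 K (th t * th s ^+ 7) = G (f (t, s)).
  move=> tF sF; rewrite /G /f /= expr_div_n -!inert_theta //; congr (sgn1 K (_ * _)).
  have s0 : th s != 0.
    by apply/eqP => h; have /eqP := inert_theta8 s sF; rewrite h expr0n eq_sym oner_eq0.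
  by apply: (mulfI s0); rewrite mulfV // -exprS inert_theta8.
transitivity (\sum_(t in Fp) \sum_(s in Fp) G (f (t, s))).
  by apply: eq_bigr => t tF; apply: eq_bigr => s sF; apply: th_ratio.
rewrite (sum_offdiag _ _ _ (fun t s => G (f (t, s)))).
have -> : \sum_(t in Fp) G (f (t, t)) = p%:Z.
  transitivity (\sum_(t in Fp) (1 : int)); last by rewrite sumr_const natz (card_primesub K p pK).
  apply: eq_bigr => t tF.
  have /andP[h _] := inert_neq0 t tF.
  by rewrite /f /= divff // /G expr1n sgn1_1.
have finj : {in offdiag _ Fp &, injective f}.
  move=> [t s] [t' s'] /offdiagP[tF sF ts] /offdiagP[tF' sF' _] e.
  have /andP[h1 h2] := inert_neq0 s sF; have /andP[h3 h4] := inert_neq0 s' sF'.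
  have e' := congr1 (fun x => x ^+ p) e.
  rewrite /f /= !expr_div_n !conj_D // in e'.
  by have [-> ->] := ratio_inj K i t s t' s' n2 i2 ts h1 h2 h3 h4 e e'.
have fim : f @: offdiag _ Fp = ~: Fp.
  apply/eqP; rewrite eqEcard; apply/andP; split; last first.
    rewrite card_in_imset // card_offdiag cardsCs setCK (card_primesub K p pK) cK; nia.
  (* The ratio is not fixed by Frobenius, because it differs from its conjugate. *)
  apply/subsetP => _ /imsetP[[t s] /offdiagP[tF sF ts] ->].
  have /andP[h1 h2] := inert_neq0 s sF; rewrite !inE /f /= expr_div_n !conj_D // eq_sym.
  by rewrite ratio_neq //; apply/eqP => h; move/eqP: i2; rewrite h expr0n eq_sym oppr_eq0 oner_eq0.
have -> : \sum_(u in offdiag _ Fp) G (f (u.1, u.2)) = \sum_(x in ~: Fp) G x.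
  by rewrite -fim big_imset //=; apply: eq_bigr => -[].
have all0 : \sum_(x : K) G x = 0.
  have [k0 k0n kn] := exists_root_N1 K n n0 n_card.
  transitivity (\sum_(x in [set: K]) G x); first by apply: eq_bigl => x; rewrite inE.
  apply: (sgn1_sum0 _ _ k0) => // x; rewrite ?inE // => _.
  by rewrite exprMn kn mulN1r.
have Fp0 : \sum_(x in Fp) G x = 0.
  have cF : #|Fp :\ 0| = (8 * k + 2)%N.
    have F0 : 0 \in Fp := primesub_nat K p pK 0.
    have := cardsD1 0 Fp; rewrite (card_primesub K p pK) F0 add1n => e.
    by apply: succn_inj; rewrite -e [LHS]pk addn3 addn2.
  (* A nonresidue of the prime field: as c^p = c, the power c^n is c^(4k+1) = c^((p-1)/2) = -1. *)
  have [||c /setD1P[c0 cFp] cn] := exists_exp_eqN1 K (Fp :\ 0) (4 * k + 1).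
  - by rewrite cF; lia.
  - move=> x /setD1P[x0 xF]; rewrite -(primesub_expp1 K p pK x xF x0); congr (_ ^+ _); lia.
  apply: (sgn1_sum0 _ _ c) => // x; last move=> xF.
    by apply/idP/idP => h; [rewrite -(mulKf c0 x)|]; rewrite (primesub_mul K p) ?(primesub_inv K p).
  rewrite exprMn; have -> : c ^+ n = -1; last by rewrite mulN1r.
  by rewrite /n exprD (mulnC k) (exprM _ p) (primesubP _ _ _ cFp) -exprD -cn; congr (_ ^+ _); lia.
have := all0; rewrite (bigID (mem Fp)) /= Fp0 add0r => h.
rewrite [X in _ + X](_ : _ = 0) ?addr0 // -[RHS]h.
by apply: eq_bigl => x; rewrite inE.
Qed.

End Inert.

(** * Conclusion *)

Lemma exists_norm_form (p : nat) : prime p -> p = 1 %[mod 8] \/ p = 3 %[mod 8] ->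
  exists x y : int, p%:Z = x ^+ 2 + 2 * y ^+ 2 /\
    (p%:Z %| 4 * x ^+ 2 - 'C(p./2, p %/ 8)%:Z ^+ 2)%Z.
Proof.
move=> pp pm; have p1 := prime_gt1 pp; set k := (p %/ 8)%N.
have p_odd : odd p by case: pm; lia.
case: pm => pm.
  have pk : p = (8 * k).+1 by rewrite /k; lia.
  have k0 : (0 < k)%N by lia.
  have pK := pchar_Fp pp; have cK := card_Fp pp.
  have [|w w4] := exists_root8 'F_p k k0; first by rewrite cK.
  apply: (norm_form_of_moment 'F_p p w (3 * k) k) => //.
  - by lia.
  - by move=> t _; apply: (split_root8 _ p).
  - by move=> t _; apply: (split_thetaN _ p).
  - by rewrite muln_gt0 k0.
  - exact: (split_moment _ p k).
have pk : p = (8 * k + 3)%N by rewrite /k; lia.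
have [K pK cK] := pPrimePowerField pp (isT : 0 < 2)%N.
have n_card : #|K| = (8 * (3 * k + 1 + k * p)).+1 by rewrite cK pk; nia.
have n_gt0 : (0 < 3 * k + 1 + k * p)%N by lia.
have [w w4] := exists_root8 K _ n_gt0 n_card.
apply: (norm_form_of_moment K p w (3 * k + 1) k) => //.
- by lia.
- by move=> t tF; rewrite /root8 (inert_theta8 K p k) ?eqxx ?orbT.
- by move=> t tF; apply: (inert_thetaN K p k).
- move=> t tF /eqP; rewrite mulf_eq0.
  by have /andP[/negbTE -> /negbTE ->] := inert_neq0 K p k pK cK pk w w4 t tF.
- exact: (inert_moment K p k).
Qed.

(** As [p] divides x^2 b^2 - y^2 a^2, it divides xb - ya or xb + ya, and a -> -a exchanges the two
    cases. By p^2 = (xa + 2yb)^2 + 2(xb - ya)^2, a multiple of [p] of the form xb - ya must be 0. *)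
Lemma norm_form_uniq (p : nat) (x y a b : int) : prime p ->
  p%:Z = x ^+ 2 + 2 * y ^+ 2 -> p%:Z = a ^+ 2 + 2 * b ^+ 2 -> x ^+ 2 = a ^+ 2.
Proof.
move=> pp exy eab; have p1 := prime_gt1 pp.
have half c d : p%:Z = c ^+ 2 + 2 * d ^+ 2 -> (p%:Z %| x * d - y * c)%Z -> x ^+ 2 = c ^+ 2.
  move=> ecd dv.
  have e0 : x * d - y * c = 0.
    apply/eqP/negPn/negP => n0.
    have le : p%:Z ^+ 2 <= (x * d - y * c) ^+ 2.
      case/dvdzP: dv n0 => q ->; rewrite mulf_eq0 negb_or => /andP[q0 _].
      have : 1 <= q ^+ 2 by rewrite -gtz0_ge1 exprn_even_gt0.
      by move=> q1; rewrite exprMn ler_peMl // sqr_ge0.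
    have e : p%:Z ^+ 2 = (x * c + 2 * y * d) ^+ 2 + 2 * (x * d - y * c) ^+ 2.
      by rewrite {1}expr2 {1}exy ecd; ring.
    have p2 : 0 < p%:Z ^+ 2 by rewrite exprn_gt0 // ltz_nat; lia.
    move: le e (sqr_ge0 (x * c + 2 * y * d)) p2.
    by move: (p%:Z ^+ 2) ((x * d - y * c) ^+ 2) ((x * c + 2 * y * d) ^+ 2) => P D C; lia.
  have : p%:Z * (d ^+ 2 - y ^+ 2) = 0.
    have -> : p%:Z * (d ^+ 2 - y ^+ 2) = (x * d - y * c) * (x * d + y * c).
      by rewrite mulrBr {1}exy ecd; ring.
    by rewrite e0 mul0r.
  move/eqP; rewrite mulf_eq0 subr_eq0 => /orP[|/eqP dy]; first by rewrite eqz_nat; lia.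
  by move: exy; rewrite ecd dy; lia.
have : (p%:Z %| (x * b - y * a) * (x * b + y * a))%Z.
  have -> : (x * b - y * a) * (x * b + y * a) = p%:Z * (b ^+ 2 - y ^+ 2).
    by rewrite mulrBr {1}exy eab; ring.
  by rewrite dvdz_mulr.
rewrite dvdzE abszM absz_nat Euclid_dvdM //.
case/orP => dv; first by apply: (half a b) => //; rewrite dvdzE.
rewrite (half (- a) b) ?sqrrN //; first by rewrite dvdzE mulrN opprK.
Qed.

Lemma numq_div_nat (z : int) (d : nat) : (0 < d)%N ->
  numq (z%:~R / d%:R) * d%:Z = z * denq (z%:~R / d%:R).
Proof.
move=> d0; apply: (@intr_inj rat); rewrite !rmorphM /= numqE.
by rewrite mulrAC mulfVK // pnatr_eq0 -lt0n.
Qed.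

(** Reduces a congruence, defined through lowest terms, to a divisibility for any fraction with
    denominator prime to [p]. *)
Lemma rat_congr_frac (p : nat) (z m : int) (d : nat) : prime p -> coprime p d ->
  (p%:Z %| z - m * d%:Z)%Z -> rat_congr p (z%:~R / d%:R) m%:~R.
Proof.
move=> pp pd dv.
have d_gt0 : (0 < d)%N.
  by case: d pd {dv} => // ; rewrite /coprime gcdn0 => /eqP p1; rewrite p1 in pp.
have pZ : coprimez p%:Z d%:Z by rewrite coprimezE.
split.
- apply: coprime_dvdr pd; rewrite -[d]absz_nat -dvdzE.
  rewrite -(Gauss_dvdzr (n := numq (z%:~R / d%:R))); last first.
    by rewrite coprimez_sym coprimezE coprime_num_den.
  by rewrite numq_div_nat // dvdz_mull.
- by rewrite /prime_to_denom denq_int coprimen1.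
rewrite -(Gauss_dvdzl _ pZ).
have -> : z%:~R / d%:R - m%:~R = (z - m * d%:Z)%:~R / d%:R :> rat.
  by rewrite rmorphB rmorphM /= mulrBl mulfK // pnatr_eq0 -lt0n.
by rewrite numq_div_nat // dvdz_mulr.
Qed.

Theorem theorem3p4 (p : nat) (p_prime : prime p) (p_odd : odd p) :
  (p = 1 %[mod 8] \/ p = 3 %[mod 8] ->
     (exists x y : int, p%:Z = x ^+ 2 + 2 * y ^+ 2) /\
     (forall x y : int, p%:Z = x ^+ 2 + 2 * y ^+ 2 ->
        rat_congr p (\sum_(0 <= n < p) (A n)%:R / 8 ^+ n) (4 * x ^+ 2)%:~R)) /\
  (p = 5 %[mod 8] \/ p = 7 %[mod 8] ->
     rat_congr p (\sum_(0 <= n < p) (A n)%:R / 8 ^+ n) 0).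
Proof.
have pF := pchar_Fp p_prime.
pose Z := (\sum_(0 <= n < p) A n * 8 ^ (p - n))%N.
(* Stated for every field with 8 != 0, to be applied both to the rationals and to the field with [p]
   elements. *)
have common_denom (F : fieldType) : 8 != 0 :> F ->
    \sum_(0 <= n < p) (A n)%:R / 8 ^+ n = Z%:R / 8 ^+ p :> F.
  move=> n8; rewrite /Z natr_sum mulr_suml; apply: eq_big_nat => n /andP[_ np].
  rewrite natrM natrX -mulrA; congr (_ * _).
  by rewrite -{2}(subnK (ltnW np)) exprD invfM mulrA mulfV ?mul1r // expf_neq0.
have congr_of (m : int) : m%:~R = \sum_(0 <= n < p) (A n)%:R / 8 ^+ n :> 'F_p ->
    rat_congr p (\sum_(0 <= n < p) (A n)%:R / 8 ^+ n) m%:~R.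
  have n8 : 8 != 0 :> 'F_p.
    by rewrite (natrM _ 2 4) mulf_neq0 ?(two_neq0 _ p) ?(four_neq0 _ p).
  have eight : (8 ^ p)%N%:Z%:~R = 8 ^+ p :> 'F_p by rewrite -natrX.
  rewrite !common_denom // => e; rewrite -natrX -[Z%:R]/(Z%:Z%:~R); apply: rat_congr_frac => //.
    by rewrite coprimeXr // (coprimeXr 3 (_ : coprime p 2)) // coprimen2.
  by rewrite (dvdz_pcharf pF) rmorphB rmorphM /= e eight mulfVK ?subrr ?expf_neq0.
have S := domb_sum_pchar 'F_p p pF p_odd.
split=> pm.
  have [a [b [eab dv]]] := exists_norm_form p p_prime pm.
  split=> [|x y exy]; first by exists a, b.
  (* Uniqueness replaces the given x^2 by the one obtained from the character sum. *)
  rewrite (norm_form_uniq p x y a b) //; apply: congr_of; rewrite S.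
  have -> : odd (p %/ 4) = false by case: pm; lia.
  by move: dv; rewrite (dvdz_pcharf pF) rmorphB subr_eq0 rmorphXn => /eqP.
rewrite -[0]/(0%:~R); apply: congr_of; rewrite S.
by have -> : odd (p %/ 4) by case: pm; lia.
Qed.
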